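(* There is a morphism from $\mathcal D_{\mathbf{\Delta}^1_1}$ to $\langle{}^\omega\omega,{}^\omega\omega,\le_{\Delta^1_1}\rangle$, and $\|\mathcal D_{\mathbf{\Delta}^1_1}\|=2^\omega$. That is, the smallest size of a family of Borel functions from ${}^\omega\omega$ to ${}^\omega\omega$ such that each Borel function from ${}^\omega\omega$ to ${}^\omega\omega$ is disjoint from some member of the family is $2^\omega$.
   Context: A challenge-response relation is a triple $\mathcal R=\langle R_-,R_+,R\rangle$ with $R\subseteq R_-\times R_+$. Its norm is $\|\mathcal R\|:=\min\{|S|:S\subseteq R_+\text{ and }(\forall c\in R_-)(\exists r\in S)\,c\,R\,r\}$. A morphism from $\langle A_-,A_+,A\rangle$ to $\langle B_-,B_+,B\rangle$ is a pair of functions $\phi_-:B_-\to A_-$, $\phi_+:A_+\to B_+$ such that $(\forall c\in B_-)(\forall r\in A_+)\ \phi_-(c)\,A\,r\Rightarrow c\,B\,\phi_+(r)$. $\mathcal D_{\mathbf{\Delta}^1_1}:=\langle\mathcal F,\mathcal F,D\rangle$, where $\mathcal F$ is the set of Borel functions from ${}^\omega\omega$ to ${}^\omega\omega$ and $f\,D\,g$ iff $f$ and $g$ are disjoint, i.e. $(\forall x\in{}^\omega\omega)\,f(x)\ne g(x)$. For $a,b\in{}^\omega\omega$, $a\le_{\Delta^1_1}b$ iff $a$ is definable by a $\Delta^1_1$ formula using $b$ as a parameter. *)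

(* Defs.v *)
From mathcomp Require Import all_boot all_order all_algebra.
From mathcomp Require Import all_classical all_reals all_analysis.

Set Implicit Arguments.
Unset Strict Implicit.
Unset Printing Implicit Defensive.

Local Open Scope classical_set_scope.
Local Open Scope card_scope.

(** * Challenge-response relations *)

Record challengeResponse := ChallengeResponse {
  challenge : Type;
  response : Type;
  meets : challenge -> response -> Prop }.

Definition adequate (A : challengeResponse) (S : set (response A)) : Prop :=
  forall c : challenge A, exists2 r, S r & meets c r.

(* There is no type of cardinals in the library: a cardinal is given by a set
   [K] having it, so that [has_norm A K] reads "the norm of [A] exists (i.e.
   there is an adequate set of least cardinality) and is the cardinality of
   [K]". *)
Definition has_norm (A : challengeResponse) (T : Type) (K : set T) : Prop :=
  exists S : set (response A),
    [/\ adequate S,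
        (forall S' : set (response A), adequate S' -> S #<= S') &
        S #= K].

Definition is_morphism (A B : challengeResponse)
    (phim : challenge B -> challenge A)
    (phip : response A -> response B) : Prop :=
  forall (c : challenge B) (r : response A),
    meets (phim c) r -> meets c (phip r).

(** * Borel functions on Baire space *)

(* [nat] is discrete here, and [{ptws nat -> nat}] carries the product
   topology. *)
Definition baire : Type := {ptws nat -> nat}.

Definition borel_baire := g_sigma_algebraType (@open {ptws nat -> nat}).

Definition borelFun : Type := {mfun borel_baire >-> borel_baire}.

Definition disjoint_graphs (f g : borelFun) : Prop :=
  forall x : baire, f x <> g x.

Definition D_borel : challengeResponse :=
  @ChallengeResponse borelFun borelFun disjoint_graphs.

(** * Second-order arithmetic and lightface definability *)

(* Two-sorted syntax with de Bruijn indices: number variables and (unary)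
   function variables are indexed separately. *)
Inductive term : Type :=
| TVar of nat
| TZero
| TSucc of term
| TAdd of term & term
| TMul of term & term
| TApp of nat & term.  (* function variable applied to a number term *)

Inductive formula : Type :=
| Eq of term & term
| Not of formula
| And of formula & formula
| Or of formula & formula
| ExN of formula
| AllN of formula
| ExF of formula
| AllF of formula.

(* Indices beyond the length of an environment denote [0], respectively the
   constant function [0]. *)
Fixpoint value (e : seq nat) (E : seq (nat -> nat)) (t : term) : nat :=
  match t with
  | TVar i => nth 0 e i
  | TZero => 0
  | TSucc t => (value e E t).+1
  | TAdd t u => value e E t + value e E u
  | TMul t u => value e E t * value e E u
  | TApp i t => nth (fun=> 0) E i (value e E t)
  end.

Fixpoint sat (e : seq nat) (E : seq (nat -> nat)) (p : formula) : Prop :=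
  match p with
  | Eq t u => value e E t = value e E u
  | Not p => ~ sat e E p
  | And p q => sat e E p /\ sat e E q
  | Or p q => sat e E p \/ sat e E q
  | ExN p => exists n : nat, sat (n :: e) E p
  | AllN p => forall n : nat, sat (n :: e) E p
  | ExF p => exists x : nat -> nat, sat e (x :: E) p
  | AllF p => forall x : nat -> nat, sat e (x :: E) p
  end.

Fixpoint arithmetical (p : formula) : bool :=
  match p with
  | Eq _ _ => true
  | Not p => arithmetical p
  | And p q | Or p q => arithmetical p && arithmetical q
  | ExN p | AllN p => arithmetical p
  | ExF _ | AllF _ => false
  end.

Fixpoint sigma11 (p : formula) : bool :=
  if p is ExF q then sigma11 q else arithmetical p.

Fixpoint pi11 (p : formula) : bool :=
  if p is AllF q then pi11 q else arithmetical p.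

(* The graph of [a] is defined, from the parameter [b], both by a Sigma^1_1
   and by a Pi^1_1 formula; in these, number variables 0 and 1 stand for the
   argument and the value, and function variable 0 for [b]. *)
Definition le_delta11 (a b : nat -> nat) : Prop :=
  exists p q : formula,
    [/\ sigma11 p, pi11 q &
        forall n m : nat,
          (a n = m <-> sat [:: n; m] [:: b] p) /\
          (a n = m <-> sat [:: n; m] [:: b] q)].

Definition delta11_relation : challengeResponse :=
  @ChallengeResponse (nat -> nat) (nat -> nat) le_delta11.

(* Main.v *)
Require Import Defs.
From mathcomp Require Import all_boot all_order all_algebra.
From mathcomp Require Import all_classical all_reals all_analysis.

(** Fix a real [a].  The codes of its finite initial segments form an infinite
    set of letters, and distinct reals give almost disjoint sets.  Letters also
    carry a value, every value being carried by infinitely many letters of each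
    [a].  The function [branch_fun a] sends [x] to the sequence of the values of
    those entries of [x] that are letters of [a].

    The heart of the proof is [countable_disjoint_branch_fun]: a Borel function
    [g] is disjoint from [branch_fun a] for only countably many [a].  Consider
    Hechler conditions [(s, h)]: a finite sequence [s], with a promise that
    every later entry [x n] is at least [h] of the initial segment of [x]
    before it.  The sets [g x i = m] are Borel, hence have the Baire property
    for the topology generated by these conditions ([almost_open_coded]), so
    countably many dense sets of conditions decide [g].  Given a dense set [D],
    all but countably many [a] satisfy: from every condition one can enter [D]
    by a finite extension containing no letter of [a] ([dense_good]).  Indeed,
    if infinitely many one-letter extensions of [s] are good in this sense,
    then so is [s], since at most one [a] has almost all of those letters;
    hence if [s] is not good, then the nodes above [s] that are not good
    contain a Hechler tree, which [D] must meet, although nodes in [D] are good.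
    For any other [a] one builds a generic [x] ([generic_real]): enter the
    [i]-th dense set without using letters of [a], which decides [g x i], then
    append one letter of [a] carrying that value.  Then [branch_fun a x = g x].

    Now let the morphism send [a] to [branch_fun a], and send [g] to a real
    coding an enumeration of the countable set of all [a] with [branch_fun a]
    disjoint from [g].  Each member of this set is a section of the code, so it
    is defined from it by a quantifier-free formula ([countable_le_delta11]).

    For the norm, an adequate family [S] assigns to every [a] a member of [S]
    disjoint from [branch_fun a], and this assignment has countable fibers.
    That suffices for the lower bound ([continuum_le_countable_fibers]), by
    diagonalizing over sequences of reals.  The upper bound holds because there
    are only continuum many Borel functions ([borelFun_le_continuum]). *)

Set Implicit Arguments.
Unset Strict Implicit.
Unset Printing Implicit Defensive.

Local Open Scope classical_set_scope.

(** * Borel subsets of Baire space *)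

Definition cylinder (s : seq nat) : set baire := [set x | mkseq x (size s) = s].

Lemma open_cylinder s : open (cylinder s : set {ptws nat -> nat}).
Proof.
elim/last_ind: s => [|s k IH].
  by rewrite (_ : cylinder _ = setT); [exact: openT | apply/seteqP; split].
have -> : cylinder (rcons s k) =
    (cylinder s `&` (fun x : {ptws nat -> nat} => x (size s)) @^-1` [set k]).
  apply/seteqP; split => x; rewrite /cylinder /= size_rcons mkseqS.
    by move=> /eqP; rewrite eqseq_rcons => /andP[/eqP -> /eqP ->].
  by case=> -> ->.
apply: openI IH _; apply: open_comp; last exact: discrete_open.
by move=> x _; exact: (@proj_continuous _ (fun=> nat) (size s) x).
Qed.

(** Otherwise, points outside [U] that agree with [x] up to [n], for every [n],
    would converge pointwise to [x]. *)
Lemma open_cylinder_sub (U : set {ptws nat -> nat}) x : open U -> U x ->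
  exists s, cylinder s x /\ cylinder s `<=` U.
Proof.
move=> oU Ux; apply: contrapT => noN.
have /choice[y yP] : forall n, exists y : baire, mkseq y n = mkseq x n /\ ~ U y.
  move=> n; apply: contrapT => noy; apply: noN.
  exists (mkseq x n); rewrite /cylinder size_mkseq; split=> // y /= yx.
  by apply: contrapT => nUy; apply: noy; exists y.
have yx : (y : nat -> {ptws nat -> nat}) @ \oo --> (x : {ptws nat -> nat}).
  apply/pointwise_cvgP => i; apply: cvg_near_cst; exists i.+1 => // n /= ltin.
  have [/(congr1 (fun s => nth 0 s i)) + _] := yP n.
  by rewrite !nth_mkseq.
have [N _ /(_ N (leqnn N)) /= UN] := yx U (open_nbhs_nbhs (conj oU Ux)).
by have [_] := yP N.
Qed.

(** The same codes serve twice: as an induction principle for Borel sets, and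
    to count the Borel functions. *)
Inductive borel_code : Type :=
| CylinderCode of seq nat
| ComplementCode of borel_code
| UnionCode of nat -> borel_code.

Fixpoint coded (c : borel_code) : set baire :=
  match c with
  | CylinderCode s => cylinder s
  | ComplementCode c => ~` coded c
  | UnionCode c => \bigcup_n coded (c n)
  end.

Lemma measurable_coded (B : set borel_baire) :
  measurable B -> exists c, coded c = B.
Proof.
have [none noneE] : exists c, coded c = set0.
  exists (ComplementCode (CylinderCode [::])).
  by apply/seteqP; split=> // x; apply.
suff : <<s @open {ptws nat -> nat} >> `<=` [set B | exists c, coded c = B].
  by apply.
apply: smallest_sub => [|U oU].
  split=> [|A [c <-]|A /choice[c cA]].
  - by exists none.
  - by exists (ComplementCode c); rewrite setTD.
  - by exists (UnionCode c); apply: eq_bigcup => // n _; rewrite cA.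
exists (UnionCode (fun n => if unpickle n is Some s then
          if `[< cylinder s `<=` U >] then CylinderCode s
          else none
        else none)).
apply/seteqP; split=> [x [n _]|x Ux].
  rewrite -/coded; case: unpickle => [s|]; last by rewrite noneE.
  by case: asboolP => [sU /sU//|_]; rewrite noneE.
have [s [xs sU]] := open_cylinder_sub oU Ux.
by exists (pickle s) => //; rewrite pickleK; case: asboolP.
Qed.

Lemma measurable_finite_support (P : seq nat -> Prop) n :
  measurable ([set x | P (mkseq x n)] : set borel_baire).
Proof.
apply: sub_gen_smallest.
have -> : [set x : nat -> nat | P (mkseq x n)] =
    \bigcup_(s in [set s | P s /\ size s = n]) cylinder s.
  apply/seteqP; split=> [x Px|x [s [Ps <-]]]; last by rewrite /cylinder /= => ->.
  by exists (mkseq x n); rewrite /cylinder /= size_mkseq.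
by apply: bigcup_open => s _; exact: open_cylinder.
Qed.

(** An open set is a countable union of cylinders, and a cylinder constrains
    finitely many coordinates. *)
Lemma measurable_fun_baire (F : borel_baire -> borel_baire) :
  (forall i m, measurable [set x | F x i = m]) -> measurable_fun setT F.
Proof.
move=> mF; apply: (@measurability _ _ borel_baire borel_baire setT F
         (@open {ptws nat -> nat}) erefl).
move=> _ [U oU <-]; rewrite setTI.
have mcyl s : measurable [set x | cylinder s (F x)].
  elim/last_ind: s => [|s k IH].
    by rewrite (_ : mkset _ = setT)//; apply/seteqP; split.
  rewrite (_ : mkset _ = [set x | cylinder s (F x)] `&` [set x | F x (size s) = k]).
    exact: measurableI.
  apply/seteqP; split => x; rewrite /cylinder /= size_rcons mkseqS.
    by move=> /eqP; rewrite eqseq_rcons => /andP[/eqP -> /eqP ->].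
  by case=> -> ->.
rewrite (_ : _ @^-1` _ = \bigcup_n
    if unpickle n is Some s then
      if `[< cylinder s `<=` U >] then [set x | cylinder s (F x)] else set0
    else set0); last first.
  apply/seteqP; split=> [x UFx|x [n _]].
    have [s [xs sU]] := open_cylinder_sub oU UFx.
    by exists (pickle s) => //; rewrite pickleK; case: asboolP.
  by case: unpickle => // s; case: asboolP => // sU /sU.
apply: bigcupT_measurable => n.
by case: asboolP => _; [exact: mcyl | exact: measurable0].
Qed.

Lemma measurable_coordinate (g : borelFun) i m :
  measurable ([set x | g x i = m] : set borel_baire).
Proof.
have m_im : measurable ([set y | y i = m] : set borel_baire).
  have -> : [set y : baire | y i = m] = [set y | nth 0 (mkseq y i.+1) i = m].
    by apply/seteqP; split=> y /=; rewrite nth_mkseq.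
  exact: (measurable_finite_support (fun s => nth 0 s i = m)).
exact: (measurable_funPTI g m_im).
Qed.

(** * Hechler conditions *)

(** A set of conditions [(s, h)]. *)
Definition hechler_set := seq nat -> (seq nat -> nat) -> Prop.

(** The path [u], starting at the node [s], stays in the Hechler tree given by
    [h]. *)
Fixpoint above (h : seq nat -> nat) (s u : seq nat) : bool :=
  if u is k :: u' then (h s <= k)%N && above h (rcons s k) u' else true.

Lemma above_cat h s u w : above h s (u ++ w) = above h s u && above h (s ++ u) w.
Proof.
elim: u s => [|k u IH] s /=; first by rewrite cats0.
by rewrite IH cat_rcons andbA.
Qed.

Lemma above_rcons h s u k :
  above h s (rcons u k) = above h s u && (h (s ++ u) <= k)%N.
Proof. by rewrite -cats1 above_cat /= andbT. Qed.

Lemma above_le (h h' : seq nat -> nat) s u : (forall r, h r <= h' r)%N ->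
  above h' s u -> above h s u.
Proof.
move=> le_hh'; elim: u s => //= k u IH s /andP[h'k /IH ->].
by rewrite (leq_trans (le_hh' s) h'k).
Qed.

Lemma above_nth h s w n : above h s w -> (size s <= n < size (s ++ w))%N ->
  (h (take n (s ++ w)) <= nth 0 (s ++ w) n)%N.
Proof.
elim/last_ind: w => [|w k IH]; first by rewrite cats0 leqNgt andNb.
rewrite above_rcons -rcons_cat size_rcons => /andP[/IH{}IH hk].
rewrite ltnS nth_rcons => /andP[sn]; rewrite leq_eqVlt => /predU1P[->|nw].
  by rewrite ltnn eqxx -cats1 take_size_cat.
rewrite nw -cats1 takel_cat; last exact: ltnW.
by rewrite IH ?sn.
Qed.

(** The branches of the Hechler tree with stem [s] given by [h]. *)
Definition in_cond (s : seq nat) (h : seq nat -> nat) : set baire :=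
  [set x | cylinder s x /\ forall n, (size s <= n)%N -> (h (mkseq x n) <= x n)%N].

Definition enters (D : hechler_set) (x : baire) : Prop :=
  exists s h, D s h /\ in_cond s h x.

Definition downward (D : hechler_set) : Prop := forall s h u h',
  D s h -> above h s u -> (forall r, h r <= h' r)%N -> D (s ++ u) h'.

Definition hechler_dense (D : hechler_set) : Prop := forall s h, exists u h',
  [/\ above h s u, (forall r, h r <= h' r)%N & D (s ++ u) h'].

Definition exterior (D : hechler_set) : hechler_set := fun s h =>
  forall u h', above h s u -> (forall r, h r <= h' r)%N -> ~ D (s ++ u) h'.

Definition dense_open (D : hechler_set) := hechler_dense D /\ downward D.

Lemma in_cond_extend s h x n : in_cond s h x -> (size s <= n)%N ->
  exists u, s ++ u = mkseq x n /\ above h s u.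
Proof.
move=> [xs hx]; elim: n => [|n IH].
  by rewrite leqn0 => /nilP ->; exists [::].
rewrite leq_eqVlt => /predU1P[<-|]; first by exists [::]; rewrite cats0 xs.
rewrite ltnS => sn; have [u [su hu]] := IH sn.
exists (rcons u (x n)); rewrite mkseqS -su rcons_cat above_rcons hu su.
by split=> //; exact: hx.
Qed.

(** Two conditions having a common branch [x] have a common extension, whose
    stem is an initial segment of [x]. *)
Lemma enters_exterior D x : downward D -> enters D x -> enters (exterior D) x ->
  False.
Proof.
move=> dD [s [h [Dsh xsh]]] [t [h' [Dth xth]]].
have [u [su hu]] := in_cond_extend xsh (leq_maxl (size s) (size t)).
have [w [tw hw]] := in_cond_extend xth (leq_maxr (size s) (size t)).
apply: (Dth w (fun r => maxn (h r) (h' r))) => // [r|]; first exact: leq_maxr.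
by rewrite tw -su; apply: (dD _ _ _ _ Dsh) => // r; exact: leq_maxl.
Qed.

Lemma downward_exterior D : downward (exterior D).
Proof.
move=> s h u h' eD hu hh' w h'' hw h'h''; rewrite -catA; apply: eD.
  by rewrite above_cat hu (above_le hh' hw).
by move=> r; exact: leq_trans (hh' r) (h'h'' r).
Qed.

Lemma dense_open_exterior D : downward D ->
  dense_open (fun s h => D s h \/ exterior D s h).
Proof.
move=> dD; split=> [s h|s h u h' [Dsh|eD] hu hh']; last 2 first.
- by left; exact: (dD _ _ _ _ Dsh).
- by right; exact: (downward_exterior eD).
have [eD|] := pselect (exterior D s h).
  by exists [::], h; split=> //; rewrite cats0; right.
move=> /existsNP[u] /existsNP[h'] /not_implyP[hu] /not_implyP[hh'] /contrapT.
by exists u, h'; split=> //; left.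
Qed.

Lemma dense_openT : dense_open (fun _ _ => True).
Proof. by split=> // s h; exists [::], h. Qed.

Lemma dense_openI D E : dense_open D -> dense_open E ->
  dense_open (fun s h => D s h /\ E s h).
Proof.
move=> [denD dD] [denE dE]; split; last first.
  move=> s h u h' [Ds Es] hu hh'.
  by split; [exact: (dD _ _ _ _ Ds) | exact: (dE _ _ _ _ Es)].
move=> s h; have [u [h1 [hu hh1 Du]]] := denD s h.
have [w [h2 [hw h12 Ew]]] := denE (s ++ u) h1.
exists (u ++ w), h2; split.
- by rewrite above_cat hu (above_le hh1 hw).
- by move=> r; exact: leq_trans (hh1 r) (h12 r).
- by rewrite catA; split=> //; exact: (dD _ _ _ _ Du).
Qed.

(** The Baire property for the topology whose basic open sets are the sets
    [in_cond s h]: up to a meager set, [B] is the open set generated by [V]. *)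
Definition almost_open (B : set baire) : Prop :=
  exists (W : nat -> hechler_set) (V : hechler_set),
    [/\ forall j, dense_open (W j), downward V &
        forall x, (forall j, enters (W j) x) -> (B x <-> enters V x)].

Lemma cylinder_cat s u x : cylinder (s ++ u) x -> cylinder s x.
Proof.
rewrite /cylinder /= => xsu; apply: (@eq_from_nth _ 0) => [|i].
  by rewrite size_mkseq.
rewrite size_mkseq => ilt; rewrite nth_mkseq//.
have := congr1 (fun r => nth 0 r i) xsu.
by rewrite nth_cat ilt nth_mkseq// size_cat ltn_addr.
Qed.

(** As for the usual Baire property: the complement of an open set is its
    exterior up to a nowhere dense set, and countably many countable families of
    dense sets form a countable family. *)
Lemma almost_open_coded c : almost_open (coded c).
Proof.
elim: c => [s|c [W [V [dW dV xV]]]|c IH] /=.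
- exists (fun _ _ _ => True), (fun t _ => exists u, t = s ++ u); split.
  + by move=> _; exact: dense_openT.
  + by move=> t h u h' [w ->] _ _; exists (w ++ u); rewrite catA.
  + move=> x _.
    split=> [xs|[_ [h [[u ->] [xt _]]]]]; last exact: cylinder_cat xt.
    by exists s, (fun=> 0); split=> //; exists [::]; rewrite cats0.
- exists (fun j => if j is j'.+1 then W j'
                   else fun s h => V s h \/ exterior V s h), (exterior V); split.
  + by case=> [|j]//; exact: dense_open_exterior.
  + exact: downward_exterior.
  + move=> x xW; have xV' := xV x (fun j => xW j.+1); split.
      move=> nxc; have [s [h [[Vs|eO] xs]]] := xW 0; last by exists s, h.
      by case: nxc; apply/xV'; exists s, h.
    by move=> xe /xV' xV''; exact: enters_exterior xV'' xe.
- have /choice[W] := IH; move=> /choice[V] WV.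
  exists (fun n => if unpickle n is Some (i, j) then W i j
                   else fun _ _ => True), (fun s h => exists i, V i s h); split.
  + move=> n; case: unpickle => [[i j]|]; last exact: dense_openT.
    by have [+ _ _] := WV i; exact.
  + move=> s h u h' [i Vi] hu hh'; exists i.
    by have [_ dV _] := WV i; exact: (dV _ _ _ _ Vi).
  + move=> x xW.
    have xWi i j : enters (W i j) x.
      by have := xW (pickle (i, j)); rewrite pickleK.
    split=> [[i _ xi]|[s [h [[i Vi] xs]]]].
      have [_ _ xV] := WV i; have [xB _] := xV x (xWi i).
      have [s [h [Vs xs]]] := xB xi.
      by exists s, h; split=> //; exists i.
    exists i => //; have [_ _ xV] := WV i; have [_] := xV x (xWi i); apply.
    by exists s, h.
Qed.

(** * The functions indexed by the branches of an almost disjoint family *)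

Definition on_branch (a : nat -> nat) (k : nat) : bool :=
  if (pickle_inv k : option (seq nat)) is Some s then s == mkseq a (size s)
  else false.

(** The length of the coded segment is read as a pair, and its second component
    is the value: thus each value occurs for infinitely many lengths. *)
Definition letter_value (k : nat) : nat :=
  if (pickle_inv k : option (seq nat)) is Some s then
    if (unpickle (size s) : option (nat * nat)) is Some (_, v) then v else 0
  else 0.

Lemma on_branch_pickle a l : on_branch a (pickle (mkseq a l)).
Proof. by rewrite /on_branch pickleK_inv size_mkseq. Qed.

Lemma on_branchP a k : on_branch a k -> exists l, k = pickle (mkseq a l).
Proof.
rewrite /on_branch; case E : (pickle_inv k) => [s|]// /eqP sa.
by exists (size s); rewrite -sa; have := @pickle_invK (seq nat) k; rewrite E.
Qed.

Lemma unbounded_injection (f : nat -> nat) N : injective f ->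
  exists j, (N <= f j)%N.
Proof.
move=> fI; apply: contrapT => /forallNP ltN.
have ltN' (i : 'I_N.+1) : (f i < N)%N by rewrite ltnNge; apply/negP/ltN.
have : injective (fun i => Ordinal (ltN' i)).
  by move=> i j /(congr1 val)/= /fI/val_inj.
by move=> /leq_card; rewrite !card_ord ltnn.
Qed.

Lemma letter_exists a v N :
  exists k, [/\ on_branch a k, (N <= k)%N & letter_value k = v].
Proof.
pose f (j : nat) : nat := pickle (mkseq a (pickle (j, v))).
have [j Nj] : exists j, (N <= f j)%N.
  apply: unbounded_injection => i j /(pcan_inj pickleK)/(congr1 size).
  by rewrite !size_mkseq => /(pcan_inj pickleK)[].
exists (f j); split=> //; first exact: on_branch_pickle.
by rewrite /letter_value pickleK_inv size_mkseq pickleK.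
Qed.

(** Letters common to [a] and [b] code segments shorter than the first
    difference of [a] and [b]. *)
Lemma branch_almost_disjoint a b : a <> b ->
  exists N, forall k, (N <= k)%N -> ~~ (on_branch a k && on_branch b k).
Proof.
move=> ab; have [i abi] : exists i, a i <> b i.
  apply: contrapT => /forallNP h; apply: ab; apply/funext => i.
  by apply: contrapT; exact: h.
exists (\max_(l < i.+1) pickle (mkseq a l)).+1 => k Nk.
apply/negP => /andP[/on_branchP[l kE]]; rewrite kE.
rewrite /on_branch pickleK_inv size_mkseq => /eqP abl.
have [il|li] := ltnP i l.
  by apply: abi; have := congr1 (nth 0 ^~ i) abl; rewrite !nth_mkseq.
move: Nk; rewrite kE ltnNge => /negP; apply.
exact: (leq_bigmax (Ordinal (li : l < i.+1)%N)).
Qed.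

(** The [i]-th letter of [a] occurring in [x], counted from 0, is at
    position [n]. *)
Definition hit (a : nat -> nat) (x : baire) (i n : nat) : bool :=
  on_branch a (x n) && (count (on_branch a) (mkseq x n) == i).

Definition branch_fun (a : nat -> nat) (x : borel_baire) : borel_baire :=
  fun i => if pselect (exists n, hit a x i n) is left ex
           then letter_value (x (ex_minn ex)) else 0.

Lemma hit_inj a x i n m : hit a x i n -> hit a x i m -> n = m.
Proof.
wlog: n m / (n <= m)%N => [W hn hm|].
  by have [nm|/ltnW mn] := leqP n m; [exact: W | apply/esym/W].
rewrite leq_eqVlt => /predU1P[//|nm] /andP[xn /eqP cn] /andP[_ /eqP cm].
have := leq_addr (count (on_branch a) [seq x j | j <- iota n.+1 (m - n.+1)])
  (count (on_branch a) (mkseq x n.+1)).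
rewrite -count_cat -map_cat -[X in iota X (m - _)]add0n -iotaD subnKC//.
by rewrite mkseqS -cats1 count_cat /= xn cn -/(mkseq x m) cm addn1 ltnn.
Qed.

Lemma branch_fun_hit a x i n :
  hit a x i n -> branch_fun a x i = letter_value (x n).
Proof.
move=> hn; rewrite /branch_fun; case: pselect => [ex|[]]; last by exists n.
by case: ex_minnP => m hm _; rewrite (hit_inj hm hn).
Qed.

(** Whether [n] is the position of the [i]-th letter depends only on the first
    [n.+1] entries of [x]; the value 0 also arises when there is no such
    position, which is the complement of an open condition. *)
Lemma measurable_branch_fun a : measurable_fun setT (branch_fun a).
Proof.
apply: measurable_fun_baire => i m.
pose P n s := [/\ on_branch a (nth 0 s n),
   count (on_branch a) (take n s) = i & letter_value (nth 0 s n) = m].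
pose Q n s := on_branch a (nth 0 s n) /\ count (on_branch a) (take n s) = i.
have hitE x n : hit a x i n <->
    on_branch a (nth 0 (mkseq x n.+1) n) /\
    count (on_branch a) (take n (mkseq x n.+1)) = i.
  rewrite nth_mkseq// mkseqS -cats1 take_size_cat ?size_mkseq//.
  by split=> [/andP[? /eqP]|[? /eqP ?]]//; apply/andP.
rewrite (_ : mkset _ = \bigcup_n [set x | P n (mkseq x n.+1)] `|`
   (if m == 0 then ~` \bigcup_n [set x | Q n (mkseq x n.+1)] else set0)).
  apply: measurableU.
    by apply: bigcupT_measurable => n; exact: measurable_finite_support.
  case: eqP => _; last exact: measurable0.
  apply: measurableC; apply: bigcupT_measurable => n.
  exact: measurable_finite_support.
apply/seteqP; split=> x /=.
  have [[n hn]|nohit] := pselect (exists n, hit a x i n).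
    rewrite (branch_fun_hit hn) => fm; left; exists n => //=.
    have [xn cn] := (hitE x n).1 hn.
    by split=> //; rewrite nth_mkseq.
  rewrite /branch_fun; case: pselect => // _ <-; right; rewrite eqxx.
  by move=> [n _ /hitE hn]; apply: nohit; exists n.
move=> [[n _ /= [xn cn <-]]|].
  by rewrite (@branch_fun_hit a x i n) ?nth_mkseq//; exact/hitE.
case: eqP => // ->; rewrite /branch_fun; case: pselect => // -[n hn] [].
by exists n => //; exact/hitE.
Qed.

Lemma branch_borel a :
  exists f : borelFun, f = branch_fun a :> (baire -> baire).
Proof. by exists (mfun_Sub (mem_set (measurable_branch_fun a))). Qed.

(** * Reaching a dense set while avoiding a branch *)

(** The promise [h] varies with the stem [s] fixed, so that the property can be
    propagated along the tree of stems. *)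
Definition reachable (a : nat -> nat) (D : hechler_set) (s : seq nat) : Prop :=
  forall h, exists u, [/\ above h s u, ~~ has (on_branch a) u &
                          exists h', D (s ++ u) h'].

Definition good (D : hechler_set) (s : seq nat) : Prop :=
  countable [set a | ~ reachable a D s].

(** The exceptional [a] are those exceptional for one of the good successors,
    and those that have as letters almost all [k] with a good successor; by
    almost disjointness there is at most one of the latter. *)
Lemma good_succ D s :
  (forall N, exists2 k, (N <= k)%N & good D (rcons s k)) -> good D s.
Proof.
move=> inf_good.
pose E0 : set (nat -> nat) :=
  [set a | exists N, forall k, (N <= k)%N -> good D (rcons s k) -> on_branch a k].
have cE0 : countable E0.
  apply/countable_injP; exists (fun=> 0) => a b; rewrite !inE => -[N Na] [M Mb] _.
  apply: contrapT => /branch_almost_disjoint[L /=].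
  have [k] := inf_good (maxn L (maxn N M)).
  rewrite !geq_max => /and3P[Lk Nk Mk] gk /(_ k Lk).
  by rewrite Na// Mb.
apply: (@sub_countable _ _ _ (E0 `|` \bigcup_(k in [set k | good D (rcons s k)])
    [set a | ~ reachable a D (rcons s k)])); last first.
  rewrite -bigcup2E; apply: bigcup_countable => // -[|[|n]] _ //=.
  exact: bigcup_countable.
apply: subset_card_le => a nra; apply: contrapT => /not_orP[aE0 ak].
apply: nra => h; have /existsNP[k] : ~ forall k, (h s <= k)%N ->
    good D (rcons s k) -> on_branch a k by move=> hk; apply: aE0; exists (h s).
move=> /not_implyP[hk] /not_implyP[gk] nak.
have /contrapT /(_ h)[u [hu nu [h' Du]]] : ~ ~ reachable a D (rcons s k).
  by move=> nr; apply: ak; exists k.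
exists (k :: u); split=> /=; first by rewrite hk.
  by rewrite negb_or nu andbT; exact/negP.
by exists h'; rewrite -cat_rcons.
Qed.

(** If [s] is not good, then by [good_succ] the nodes that are not good contain
    the Hechler tree with stem [s] given by [h]; density yields a node of
    this tree that is the stem of a condition in [D], hence good. *)
Lemma dense_good D : hechler_dense D -> forall s, good D s.
Proof.
move=> denD s; apply: contrapT => bad_s.
have /choice[h hP] : forall t, exists N, ~ good D t ->
    forall k, (N <= k)%N -> ~ good D (rcons t k).
  move=> t; have [gt|bt] := pselect (good D t); first by exists 0.
  have /existsNP[N NP] : ~ forall N, exists2 k, (N <= k)%N & good D (rcons t k).
    by move=> /good_succ.
  by exists N => _ k Nk gk; apply: NP; exists k.
have [u [h' [hu _ Du]]] := denD s h.
have : ~ good D (s ++ u).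
  elim/last_ind: u hu {Du} => [|u k IH]; first by rewrite cats0.
  by rewrite above_rcons -rcons_cat => /andP[/IH bu hk]; exact: hP hk.
apply; rewrite /good (_ : mkset _ = set0)//.
apply/seteqP; split=> // a; apply => h1.
by exists [::]; split=> //; exists h'; rewrite cats0.
Qed.

(** * A generic real on which a Borel function meets the given one *)

(** The stage [i] enters [F i] along a path [u] without letters of [a], then
    appends a letter [k] of [a].  So this [k] is the [i]-th letter of [a] in
    the limit [x], and its value can be chosen freely, depending on the
    condition just reached. *)
Lemma generic_real a (F : nat -> hechler_set)
    (v : nat -> seq nat -> (seq nat -> nat) -> nat) :
  (forall i, downward (F i)) -> (forall i s, reachable a (F i) s) ->
  exists (x : baire) (S : nat -> seq nat) (H : nat -> seq nat -> nat),
    forall i, [/\ F i (S i) (H i), in_cond (S i) (H i) x &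
                  branch_fun a x i = v i (S i) (H i)].
Proof.
move=> dF rF.
have /choice[f fP] : forall p : nat * (seq nat * (seq nat -> nat)),
    exists q : seq nat * nat * (seq nat -> nat), let: (i, (s, h)) := p in
      let: (u, k, h') := q in
      [/\ above h s (rcons u k) /\ (forall r, h r <= h' r)%N,
          F i (s ++ u) h', ~~ has (on_branch a) u, on_branch a k &
          (h' (s ++ u) <= k)%N /\ letter_value k = v i (s ++ u) h'].
  case=> i [s h]; have [u [hu nu [h1 Fu]]] := rF i s h.
  pose h' r := maxn (h r) (h1 r).
  have [k [ak hk vk]] := letter_exists a (v i (s ++ u) h') (h' (s ++ u)).
  have hh' r : (h r <= h' r)%N by exact: leq_maxl.
  exists (u, k, h'); split=> //.
    by split=> //; rewrite above_rcons hu (leq_trans (hh' _) hk).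
  rewrite -[s ++ u]cats0; apply: (dF _ _ _ _ _ Fu) => // r.
  exact: leq_maxr.
pose U i p := (f (i, p)).1.1.
pose K i p := (f (i, p)).1.2.
(* [st i] is the condition at the start of stage [i]. *)
have [st st0 stS] : exists2 st : nat -> seq nat * (seq nat -> nat),
    st 0 = ([::], fun=> 0) & forall j, st j.+1 =
      ((st j).1 ++ rcons (U j (st j)) (K j (st j)), (f (j, st j)).2).
  by exists (fix st i := if i is j.+1 then
    ((st j).1 ++ rcons (U j (st j)) (K j (st j)), (f (j, st j)).2)
    else ([::], fun=> 0)).
have stP i : [/\ above (st i).2 (st i).1 (rcons (U i (st i)) (K i (st i))) /\
     (forall r, (st i).2 r <= (st i.+1).2 r)%N,
     F i ((st i).1 ++ U i (st i)) (st i.+1).2,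
     ~~ has (on_branch a) (U i (st i)), on_branch a (K i (st i)) &
     ((st i.+1).2 ((st i).1 ++ U i (st i)) <= K i (st i))%N /\
     letter_value (K i (st i)) = v i ((st i).1 ++ U i (st i)) (st i.+1).2].
  have := fP (i, st i); rewrite stS /U /K /=.
  by case: (st i) => s h; case: (f _) => [[u k] h'].
have ext i d : exists w, [/\ (st (i + d)).1 = (st i).1 ++ w,
    above (st i).2 (st i).1 w & forall r, ((st i).2 r <= (st (i + d)).2 r)%N].
  elim: d => [|d [w [sw hw hd]]].
    by exists [::]; rewrite addn0 cats0.
  rewrite addnS; have [[hu hh] _ _ _ _] := stP (i + d).
  exists (w ++ rcons (U (i + d) (st (i + d))) (K (i + d) (st (i + d)))); split.
  - by rewrite stS /= sw catA.
  - by rewrite above_cat hw -sw (above_le hd hu).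
  - by move=> r; exact: leq_trans (hd r) (hh r).
have le_size i : (i <= size (st i).1)%N.
  elim: i => // i IH; rewrite stS size_cat size_rcons addnS ltnS.
  exact: leq_trans IH (leq_addr _ _).
pose x : baire := fun n => nth 0 (st n.+1).1 n.
have nth_st i n : (n < size (st i).1)%N -> nth 0 (st i).1 n = x n.
  move=> ni; have [w [e _ _]] := ext i n.+1; have [w' [e' _ _]] := ext n.+1 i.
  have : nth 0 (st (i + n.+1)).1 n = nth 0 (st (n.+1 + i)).1 n by rewrite addnC.
  by rewrite e e' !nth_cat ni le_size.
have x_st i : mkseq x (size (st i).1) = (st i).1.
  apply: (@eq_from_nth _ 0) => [|n]; rewrite size_mkseq// => ni.
  by rewrite nth_mkseq// nth_st.
have in_st i : in_cond (st i).1 (st i).2 x.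
  split=> [|n sn]; first exact: x_st.
  have [w [e hw _]] := ext i n.+1.
  have nlt : (n < size (st (i + n.+1)).1)%N.
    by apply: leq_trans (le_size _); rewrite addnS ltnS leq_addl.
  have <- : take n ((st i).1 ++ w) = mkseq x n.
    rewrite -e -x_st /mkseq -map_take take_iota.
    by congr (map _ (iota _ _)); exact/minn_idPl/ltnW.
  have <- : nth 0 ((st i).1 ++ w) n = x n by rewrite -e nth_st.
  by apply: above_nth; rewrite // sn -e.
have count_st i : count (on_branch a) (st i).1 = i.
  elim: i => [|i IH]; first by rewrite st0.
  have [_ _ nu ak _] := stP i; rewrite stS /=.
  rewrite count_cat -cats1 count_cat IH /= ak.
  by move: nu; rewrite has_count -leqNgt leqn0 => /eqP ->; rewrite addn1.
exists x, (fun i => (st i).1 ++ U i (st i)), (fun i => (st i.+1).2) => i.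
have [[hu hh] Fi nu ak [hk vk]] := stP i.
set s' := (st i).1 ++ U i (st i).
have st_s' : (st i.+1).1 = rcons s' (K i (st i)) by rewrite stS -rcons_cat.
have [xs' hx] := in_st i.+1.
have {xs'} : mkseq x (size s').+1 = rcons s' (K i (st i)).
  by rewrite -st_s' -x_st st_s' size_rcons.
rewrite mkseqS => /eqP; rewrite eqseq_rcons => /andP[/eqP xs' /eqP xk].
split=> //.
  split=> [//|n]; rewrite leq_eqVlt => /predU1P[<-|sn].
    by rewrite xs' xk.
  by apply: hx; rewrite st_s' size_rcons.
rewrite -vk -xk; apply: branch_fun_hit.
rewrite /hit xk ak xs' count_cat count_st.
by move: nu; rewrite has_count -leqNgt leqn0 => /eqP ->; rewrite addn0 eqxx.
Qed.

(** The dense set of stage [i] enters one of the countably many dense sets that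
    make the opens [V (i, m)] agree with [g x i = m], and then either enters some
    [V (i, m)] or excludes all of them.  The latter cannot happen along the
    generic [x], because [g x i] has some value. *)
Lemma countable_disjoint_branch_fun (g : borelFun) :
  countable [set a | forall x, branch_fun a x <> g x].
Proof.
have ao i m : almost_open [set x | g x i = m].
  have [c <-] : exists c, coded c = [set x | g x i = m].
    by apply: measurable_coded; exact: measurable_coordinate.
  exact: almost_open_coded.
have /choice[W] : forall p : nat * nat, almost_open [set x | g x p.1 = p.2].
  by move=> [i m]; exact: ao.
move=> /choice[V WV].
pose W' n : hechler_set := if (unpickle n : option (nat * nat * nat)) is
  Some (p, j) then W p j else fun _ _ => True.
pose O i : hechler_set := fun s h => exists m, V (i, m) s h.
have dO i : downward (O i).
  move=> s h u h' [m Vs] hu hh'; exists m.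
  by have [_ dV _] := WV (i, m); exact: (dV _ _ _ _ Vs).
pose F i : hechler_set := fun s h => W' i s h /\ (O i s h \/ exterior (O i) s h).
have dF i : dense_open (F i).
  apply: dense_openI; last exact: dense_open_exterior.
  rewrite /W'; case: unpickle => [[p j]|]; last exact: dense_openT.
  by have [+ _ _] := WV p; exact.
apply: (@sub_countable _ _ _
    (\bigcup_i \bigcup_s [set a | ~ reachable a (F i) s])); last first.
  apply: bigcup_countable => // i _; apply: bigcup_countable => // s _.
  by apply: dense_good; have [] := dF i.
apply: subset_card_le => a dis; apply: contrapT => na.
have rF i s : reachable a (F i) s.
  by apply: contrapT => nr; apply: na; exists i => //; exists s.
pose v i s h := if pselect (O i s h) is left Os then sval (cid Os) else 0.
have [x [S [H xP]]] := generic_real v (fun i => (dF i).2) rF.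
have xW p j : enters (W p j) x.
  exists (S (pickle (p, j))), (H (pickle (p, j))).
  by have [[+ _] xS _] := xP (pickle (p, j)); rewrite /W' pickleK.
apply: (dis x); apply/funext => i.
have [[_ Fi] xS ->] := xP i; rewrite /v; case: pselect => [Os|nOs].
  case: cid => m /= Vm; apply/esym.
  have [_ _ xV] := WV (i, m); apply/(xV x (xW _)).
  by exists (S i), (H i).
case: Fi => // eO; exfalso.
apply: (@enters_exterior (O i) x) => //; last by exists (S i), (H i).
have [_ _ xV] := WV (i, g x i).
have [+ _] := xV x (xW _); move=> /(_ erefl)[s [h [Vs xs]]].
by exists s, h; split=> //; exists (g x i).
Qed.

(** * Members of a countable set are definable from an enumeration of it *)

(** The pair [(k, n)] is coded as [2 ^ k * (n + n).+1], which for a fixed [k] is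
    a term of arithmetic in [n]. *)
Definition enumeration_code (e : nat -> nat -> nat) (N : nat) : nat :=
  e (logn 2 N) (N %/ 2 ^ logn 2 N)./2.

Lemma enumeration_codeE e k n : enumeration_code e (2 ^ k * (n + n).+1) = e k n.
Proof.
have lognE : logn 2 (2 ^ k * (n + n).+1) = k.
  rewrite lognM ?expn_gt0// pfactorK// lognE /= dvdn2 addnn /= odd_double.
  by rewrite addn0.
by rewrite /enumeration_code lognE mulKn ?expn_gt0// addnn /= uphalf_double.
Qed.

Lemma le_delta11_enumeration e k : le_delta11 (e k) (enumeration_code e).
Proof.
pose numeral j := iter j TSucc TZero.
have numeralE j l E : value l E (numeral j) = j by elim: j => //= j ->.
pose p := Eq (TVar 1)
  (TApp 0 (TMul (numeral (2 ^ k)) (TSucc (TAdd (TVar 0) (TVar 0))))).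
exists p, p; split=> // n m.
have -> : sat [:: n; m] [:: enumeration_code e] p <-> e k n = m.
  by rewrite /= numeralE enumeration_codeE; split.
by split.
Qed.

Lemma countable_le_delta11 (C : set (nat -> nat)) : countable C ->
  exists b, forall a, C a -> le_delta11 a b.
Proof.
move=> /countable_injP[f fI].
have /choice[e eP] : forall k, exists b, forall a, C a -> f a = k -> a = b.
  move=> k; have [[b [Cb fb]]|nC] := pselect (exists b, C b /\ f b = k).
    by exists b => a Ca fa; apply: fI; rewrite ?inE// fa.
  by exists (fun=> 0) => a Ca fa; case: nC; exists a.
exists (enumeration_code e) => a Ca.
by rewrite (eP (f a) a Ca erefl); exact: le_delta11_enumeration.
Qed.

(** * Cardinality of the continuum *)

Local Open Scope card_scope.

Lemma injection_card_le T U (A : set T) (B : set U) (f : T -> U) :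
  (forall x, A x -> B (f x)) ->
  (forall x y, A x -> A y -> f x = f y -> x = y) -> A #<= B.
Proof.
move=> fAB fI; have [g] : $|{injfun A >-> B}|.
  by apply/injfunPex; exists f => // x y; rewrite !inE; exact: fI.
exact: inj_card_le g.
Qed.

(** A real codes a sequence [z] of reals.  Let [Z z] be the index of [z] within
    the countable fiber of [f] that contains it.  If for each [n] some real were
    not the [n]-th entry of any [z] with [Z z = n], then the sequence of these
    reals would contradict itself at [n := Z z].  So for some [n] every real [x]
    is the [n]-th entry of a [z x] with index [n]; as [f] is injective on the
    sequences of index [n], it maps the [z x] injectively into [S]. *)
Lemma continuum_le_countable_fibers Y (S : set Y)
    (r : (nat -> nat) -> Y -> Prop) :
  (forall a, exists2 y, S y & r a y) -> (forall y, countable [set a | r a y]) ->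
  [set: nat -> bool] #<= S.
Proof.
move=> rS rc.
have /choice[f fP] : forall a, exists y, S y /\ r a y.
  by move=> a; have [y] := rS a; exists y.
have /choice[idx idxI] : forall y, exists j : (nat -> nat) -> nat,
    {in [set a | r a y] &, injective j}.
  by move=> y; exact/countable_injP.
pose enc (z : nat -> nat -> bool) : nat -> nat := fun N =>
  if (unpickle N : option (nat * nat)) is Some (n, k) then z n k : nat else 0.
have encI : injective enc.
  move=> z z' zz'; apply/funext => n; apply/funext => k.
  have := congr1 (@^~ (pickle (n, k))) zz'; rewrite /enc pickleK.
  by case: (z n k); case: (z' n k).
pose Z z := idx (f (enc z)) (enc z).
have [n nP] : exists n, forall x : nat -> bool, exists z, z n = x /\ Z z = n.
  apply: contrapT => /forallNP nZ.
  have /choice[z zP] : forall n, exists x : nat -> bool,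
      ~ exists z, z n = x /\ Z z = n.
    by move=> n; exact/existsNP.
  by apply: (zP (Z z)); exists z.
have /choice[z zP] := nP.
apply: (@injection_card_le _ _ _ _ (fun x => f (enc (z x)))) => [x _|x y _ _ fxy].
  by have [] := fP (enc (z x)).
have [zx Zx] := zP x; have [zy Zy] := zP y; rewrite -zx -zy.
suff /encI -> : enc (z x) = enc (z y) by [].
apply: (idxI (f (enc (z x)))).
- by rewrite inE; have [] := fP (enc (z x)).
- by rewrite inE fxy; have [] := fP (enc (z y)).
- by rewrite [LHS]Zx fxy [RHS]Zy.
Qed.

(** A code is a well-founded tree; this function gives the label of its node at
    the end of the path [p], and determines the code. *)
Fixpoint code_label (c : borel_code) (p : seq nat) : nat :=
  match c, p with
  | CylinderCode s, _ => (pickle s).+2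
  | ComplementCode c, [::] => 0
  | ComplementCode c, _ :: p => code_label c p
  | UnionCode c, [::] => 1
  | UnionCode c, n :: p => code_label (c n) p
  end.

Lemma code_label_inj : injective code_label.
Proof.
elim=> [s|c IH|c IH] [s'|c'|c'] /[dup] e /(congr1 (@^~ [::]))//=.
- by move=> [/(pcan_inj pickleK) ->].
- move=> _; rewrite (IH c')//; apply/funext => p.
  exact: (congr1 (@^~ (0 :: p)) e).
- move=> _; congr UnionCode; apply/funext => n; apply: IH; apply/funext => p.
  exact: (congr1 (@^~ (n :: p)) e).
Qed.

(** A Borel function is determined by codes for the sets [g x i = m], and the
    labels of countably many codes fit into one real. *)
Lemma borelFun_le_continuum : [set: borelFun] #<= [set: nat -> bool].
Proof.
have /choice[c cP] : forall q : borelFun * (nat * nat),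
    exists c, coded c = [set x | q.1 x q.2.1 = q.2.2].
  by move=> [g [i m]]; apply: measurable_coded; exact: measurable_coordinate.
pose F (g : borelFun) (N : nat) : bool :=
  if (unpickle N : option (nat * nat * (seq nat * nat))) is Some (q, (p, v))
  then code_label (c (g, q)) p == v else false.
apply: (@injection_card_le _ _ _ _ F) => // g g' _ _ Fgg'.
apply/mfuneqP => x; apply/funext => i.
have /code_label_inj cE : code_label (c (g, (i, g' x i))) =
    code_label (c (g', (i, g' x i))).
  apply/funext => p; apply/eqP.
  have := congr1 (@^~ (pickle ((i, g' x i : nat),
    (p, code_label (c (g', (i, g' x i))) p)))) Fgg'.
  by rewrite /F pickleK eqxx => ->.
have := cP (g, (i, g' x i)); rewrite cE cP => /seteqP[/(_ x)/= + _].
by move=> /(_ erefl) ->.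
Qed.

(** The function [g] is disjoint from [fun x i => (g x i).+1]. *)
Lemma adequate_borelFun : @adequate D_borel [set: borelFun].
Proof.
move=> g; pose F (x : borel_baire) : borel_baire := fun i => (g x i).+1.
have mF : measurable_fun setT F.
  apply: measurable_fun_baire => i [|m].
    by rewrite (_ : mkset _ = set0); [exact: measurable0|by apply/seteqP; split].
  rewrite (_ : mkset _ = [set x | g x i = m]); first exact: measurable_coordinate.
  by apply/seteqP; split=> x /=; [case|rewrite /F => ->].
exists (mfun_Sub (mem_set mF)) => // x /(congr1 (@^~ 0)) /= /eqP.
by rewrite /F eqn_leq ltnn andbF.
Qed.

Theorem mainTheorem3 :
  (exists (phim : challenge delta11_relation -> challenge D_borel)
          (phip : response D_borel -> response delta11_relation),
      is_morphism phim phip)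
  /\ has_norm D_borel [set: nat -> bool].
Proof.
have /choice[f fE] := branch_borel.
have cdis (g : borelFun) : countable [set a | disjoint_graphs (f a) g].
  rewrite (_ : mkset _ = [set a | forall x, branch_fun a x <> g x]).
    exact: countable_disjoint_branch_fun.
  by apply/seteqP; split=> a dis x; have := dis x; rewrite ?fE// -fE.
split.
  have /choice[b bP] : forall g : borelFun,
      exists b, forall a, disjoint_graphs (f a) g -> le_delta11 a b.
    by move=> g; exact: (countable_le_delta11 (cdis g)).
  by exists f, b => a g; exact: bP.
have lower (S : set borelFun) : @adequate D_borel S -> [set: nat -> bool] #<= S.
  move=> adS; pose r a (g : borelFun) := disjoint_graphs (f a) g.
  have rS a : exists2 g, S g & r a g by exact: adS (f a).
  exact: continuum_le_countable_fibers rS cdis.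
exists [set: borelFun]; split.
- exact: adequate_borelFun.
- by move=> S /lower; exact: card_le_trans borelFun_le_continuum.
- by rewrite card_eq_le borelFun_le_continuum lower//; exact: adequate_borelFun.
Qed.
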